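(* Let $n\ge 3$ and let $BS_n$ be the $n$-dimensional bubble-sort star graph. Then $\mathrm{mp}(BS_n)=2n-3$.
   Context: For a permutation $v=v_1v_2\cdots v_n$ of $[1,n]=\{1,\dots,n\}$ and distinct $i,j\in[1,n]$, $v\circ\langle i,j\rangle$ denotes the permutation obtained from $v$ by exchanging the entries in positions $i$ and $j$. The $n$-dimensional bubble-sort star graph $BS_n$ ($n\ge 2$) has as vertex set all permutations of $[1,n]$, and two distinct vertices $u,v$ are adjacent iff $u=v\circ\langle 1,i\rangle$ for some $i\in[2,n]$, or $u=v\circ\langle i-1,i\rangle$ for some $i\in[3,n]$. A perfect matching covers every vertex; an almost-perfect matching covers all vertices but one. The matching preclusion number $\mathrm{mp}(G)$ is the minimum size of an edge set $F\subseteq E(G)$ such that $G-F$ (delete the edges of $F$, keep all vertices) has neither a perfect matching nor an almost-perfect matching. *)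

(* Defs.v *)
From mathcomp Require Import all_boot all_fingroup.

Set Implicit Arguments.
Unset Strict Implicit.
Unset Printing Implicit Defensive.

Record sgraph := SGraph {
  vertex :> finType;
  adj : rel vertex;
  adj_sym : symmetric adj;
  adj_irrefl : irreflexive adj }.

Definition edges (G : sgraph) : {set {set G}} :=
  [set [set p.1; p.2] | p : G * G & adj p.1 p.2].

Section DeleteEdges.
Variables (G : sgraph) (F : {set {set G}}).

Definition del_adj : rel G := fun x y => adj x y && ([set x; y] \notin F).

Fact del_adj_sym : symmetric del_adj.
Proof. by move=> x y; rewrite /del_adj adj_sym setUC. Qed.

Fact del_adj_irrefl : irreflexive del_adj.
Proof. by move=> x; rewrite /del_adj adj_irrefl. Qed.

Definition del_edges : sgraph := SGraph del_adj_sym del_adj_irrefl.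

End DeleteEdges.

Section Matching.
Variable G : sgraph.

Definition matching (M : {set {set G}}) : bool :=
  (M \subset edges G) && trivIset M.

Definition perfect_matching (M : {set {set G}}) : bool :=
  matching M && (cover M == [set: G]).

Definition almost_perfect_matching (M : {set {set G}}) : bool :=
  matching M && (#|~: cover M| == 1).

End Matching.

Definition precluding (G : sgraph) (F : {set {set G}}) : bool :=
  [&& F \subset edges G,
      ~~ [exists M, @perfect_matching (del_edges F) M]
    & ~~ [exists M, @almost_perfect_matching (del_edges F) M]].

(* [edges G] only seeds the minimum: by [precluding_edges] it is precluding
   as soon as [G] has two vertices, and then [mpP] shows that [mp G] is the
   minimum size of a precluding set. On fewer vertices no set is precluding
   and the value is irrelevant. *)
Definition mp (G : sgraph) : nat :=
  #|[arg min_(F < edges G | precluding F) #|F|]|.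

Lemma precluding_edges (G : sgraph) : 1 < #|G| -> precluding (edges G).
Proof.
move=> G_gt1.
have E0 : edges (del_edges (edges G)) = set0.
  apply/setP=> A; rewrite inE; apply/negP=> /imsetP[[x y]].
  rewrite inE /= /del_adj => /andP[xy /negP nE] _; apply: nE.
  by apply/imsetP; exists (x, y); rewrite ?inE.
have M0 M : @matching (del_edges (edges G)) M -> cover M = set0.
  by rewrite /matching E0 subset0 => /andP[/eqP -> _]; rewrite /cover big_set0.
rewrite /precluding subxx /=; apply/andP; split; apply/existsP=> -[M] /andP[/M0 ->].
  by move=> /eqP h; move: G_gt1; rewrite -cardsT -[[set: G]]h cards0.
by rewrite setC0 cardsT => /eqP h; move: G_gt1; rewrite h.
Qed.

Lemma mpP (G : sgraph) : 1 < #|G| ->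
  (exists2 F : {set {set G}}, precluding F & #|F| = mp G) /\
  (forall F : {set {set G}}, precluding F -> mp G <= #|F|).
Proof.
move=> /precluding_edges pE; rewrite /mp.
by case: arg_minnP => // F pF minF; split; first exists F.
Qed.

Section BubbleSortStar.
Variable n : nat.
Implicit Types u v : 'S_n.

(* A permutation v_1 ... v_n is v : 'S_n with [v i] the entry in position i,
   positions and entries being numbered from 0. MathComp composes permutations
   from left to right, so [swap v i j] maps position k to [v (tperm i j k)]. *)
Definition swap v (i j : 'I_n) : 'S_n := (tperm i j * v)%g.

(* Numbered from 0, the exchanges <1,i> with 2 <= i <= n and <i-1,i> with
   3 <= i <= n. *)
Definition star_pair (i j : 'I_n) : bool := (i == 0 :> nat) && (1 <= j).
Definition bubble_pair (i j : 'I_n) : bool := (j == i.+1 :> nat) && (2 <= j).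

Definition BS_adj : rel 'S_n := fun u v =>
  (u != v) &&
  [exists i : 'I_n, exists j : 'I_n,
     (star_pair i j || bubble_pair i j) && (u == swap v i j)].

Fact BS_adj_sym : symmetric BS_adj.
Proof.
have imp u v : BS_adj u v -> BS_adj v u.
  case/andP=> uv /existsP[i /existsP[j /andP[ij /eqP def_u]]].
  rewrite /BS_adj eq_sym uv; apply/existsP; exists i; apply/existsP; exists j.
  by rewrite ij def_u /swap mulgA tperm2 mul1g eqxx.
by move=> u v; apply/idP/idP; apply: imp.
Qed.

Fact BS_adj_irrefl : irreflexive BS_adj.
Proof. by move=> u; rewrite /BS_adj eqxx. Qed.

Definition BS : sgraph := SGraph BS_adj_sym BS_adj_irrefl.

End BubbleSortStar.

(* Main.v *)
Require Import Defs.
From mathcomp Require Import all_boot all_fingroup.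

(** The graph is properly edge-coloured by its 2n-3 generating transpositions:
    for each transposition t the edges {v, t v} form a perfect matching, and
    these matchings are pairwise disjoint, so that a precluding set must meet
    all of them. Conversely, the 2n-3 edges at one vertex form a precluding set:
    deleting them isolates the vertex, and since the number of vertices is even
    an almost-perfect matching is impossible for parity reasons. *)

Lemma edgesP (G : sgraph) (A : {set G}) :
  reflect (exists x y, adj x y /\ A = [set x; y]) (A \in edges G).
Proof.
apply: (iffP imsetP) => [[[x y]]|[x [y [xy ->]]]].
  by rewrite inE /= => xy ->; exists x, y.
by exists (x, y); rewrite ?inE.
Qed.

Lemma card_edge (G : sgraph) (A : {set G}) : A \in edges G -> #|A| = 2.
Proof.
case/edgesP=> x [y [xy ->]]; rewrite cards2; case: eqVneq xy => // ->.
by rewrite adj_irrefl.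
Qed.

Lemma card_cover_matching (G : sgraph) (M : {set {set G}}) :
  matching M -> #|cover M| = #|M| * 2.
Proof.
case/andP=> /subsetP sM /eqP <-.
by rewrite -sum_nat_const; apply: eq_bigr => A /sM /card_edge.
Qed.

Lemma edges_del (G : sgraph) (F : {set {set G}}) :
  edges (del_edges F) = edges G :\: F.
Proof.
apply/setP=> A; rewrite inE; apply/edgesP/andP.
  by case=> x [y [/andP[xy nF] ->]]; split=> //; apply/edgesP; exists x, y.
case=> nF /edgesP[x [y [xy defA]]]; exists x, y.
by rewrite /= /del_adj xy -defA.
Qed.

Lemma set2_inj (T : finType) (x y z : T) : [set x; y] = [set x; z] -> y = z.
Proof.
move=> /setP e; move: (e y) (e z); rewrite !inE !eqxx !orbT.
by case/esym/orP=> /eqP // -> /orP[] /eqP.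
Qed.

Section OneFactorization.

Variables (G : sgraph) (I : finType) (s : I -> G -> G).
Hypothesis sK : forall i, involutive (s i).
Hypothesis s_inj : forall x, injective (s^~ x).
Hypothesis adjE : forall x y, adj x y = [exists i, y == s i x].

Definition factor i : {set {set G}} := [set [set x; s i x] | x : G].

Lemma adj_factor x i : adj x (s i x).
Proof. by rewrite adjE; apply/existsP; exists i. Qed.

(** As [s i] is an involution, an edge of colour [i] has the same form seen from either endpoint.
    Disjointness within a factor and between factors both rest on this. *)
Lemma mem_factor i (A : {set G}) x :
  A \in factor i -> x \in A -> A = [set x; s i x].
Proof.
case/imsetP=> y _ ->; rewrite !inE => /orP[] /eqP -> //.
by rewrite sK setUC.
Qed.

Lemma factor_inj i j A : A \in factor i -> A \in factor j -> i = j.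
Proof.
move=> Ai Aj; have [x _ defA] := imsetP Ai.
have xA : x \in A by rewrite defA set21.
apply: (s_inj x); apply: (@set2_inj _ x).
by rewrite -(mem_factor _ _ _ Ai xA) -(mem_factor _ _ _ Aj xA).
Qed.

Lemma factor_sub_edges i : factor i \subset edges G.
Proof.
by apply/subsetP=> A /imsetP[x _ ->]; apply/edgesP; exists x, (s i x); rewrite adj_factor.
Qed.

Lemma trivIset_factor i : trivIset (factor i).
Proof.
apply/trivIsetP=> A B Ai Bi; apply: contraR => /pred0Pn[x /andP[/= xA xB]].
by rewrite (mem_factor _ _ _ Ai xA) (mem_factor _ _ _ Bi xB).
Qed.

Lemma cover_factor i : cover (factor i) = [set: G].
Proof.
apply/setP=> x; rewrite inE; apply/bigcupP.
by exists [set x; s i x]; [apply: imset_f | apply: set21].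
Qed.

Lemma perfect_matching_factor i (F : {set {set G}}) :
  [disjoint factor i & F] -> @perfect_matching (del_edges F) (factor i).
Proof.
move=> dF; rewrite /perfect_matching /matching edges_del subsetD dF.
by rewrite factor_sub_edges trivIset_factor cover_factor /=.
Qed.

(** Picking an edge of [F] in each factor is injective, since an edge determines its colour
    ([factor_inj]). *)
Lemma leq_card_precluding (F : {set {set G}}) : precluding F -> #|I| <= #|F|.
Proof.
case/and3P=> _ /existsPn noperf _.
have meet i : exists A, (A \in factor i) && (A \in F).
  apply/existsP; apply: contraNT (noperf (factor i)) => /existsPn dF.
    by apply: perfect_matching_factor; apply/pred0P=> A; apply/negbTE/dF.
pose pick i := xchoose (meet i).
have pickP i : (pick i \in factor i) && (pick i \in F) := xchooseP (meet i).
have pick_inj : injective pick.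
  move=> i j eij; case/andP: (pickP i) => Ai _; case/andP: (pickP j) => Aj _.
  by apply: factor_inj Ai _; rewrite eij.
rewrite -cardsT -(card_imset _ pick_inj); apply/subset_leq_card/subsetP.
by move=> _ /imsetP[i _ ->]; case/andP: (pickP i).
Qed.

Lemma even_card_factor (i : I) : ~~ odd #|G|.
Proof.
have Mi : matching (factor i).
  by rewrite /matching factor_sub_edges trivIset_factor.
by rewrite -cardsT -(cover_factor i) card_cover_matching // oddM andbF.
Qed.

Definition star x : {set {set G}} := [set [set x; s i x] | i : I].

Lemma card_star x : #|star x| = #|I|.
Proof. by apply: card_imset => i j /set2_inj; apply: s_inj. Qed.

Lemma precluding_star x (i : I) : precluding (star x).
Proof.
have isolated M : @matching (del_edges (star x)) M -> x \notin cover M.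
  rewrite /matching edges_del => /andP[/subsetP sM _].
  apply/bigcupP=> -[A /sM]; rewrite inE => /andP[/negP nA /edgesP[y [z [yz defA]]]].
  (* Whichever endpoint [x] is, the other one is some [s j x], so the edge was deleted. *)
  rewrite defA !inE => /orP[] /eqP ex; apply: nA; rewrite defA -ex.
    by move: yz; rewrite -ex adjE => /existsP[j /eqP ->]; apply: imset_f.
  move: yz; rewrite -ex adj_sym adjE => /existsP[j /eqP ->].
  by rewrite setUC; apply: imset_f.
apply/and3P; split.
- apply/subsetP=> _ /imsetP[j _ ->]; apply/edgesP.
  by exists x, (s j x); rewrite adj_factor.
- by apply/existsP=> -[M /andP[/isolated nx /eqP cM]]; rewrite cM inE in nx.
(* Otherwise [#|G|] would be [#|M| * 2 + 1], which is odd. *)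
apply/existsP=> -[M /andP[/card_cover_matching cM /eqP c1]].
have := even_card_factor i; have := cardsC (cover M).
by rewrite c1 cM => <-; rewrite oddD oddM andbF.
Qed.

Lemma mp_one_factorization (x : G) (i : I) : mp G = #|I|.
Proof.
(* A positive even number is at least 2. *)
have G_gt1 : 1 < #|G|.
  have G_gt0 : 0 < #|G| by apply/card_gt0P; exists x.
  by move: (even_card_factor i) G_gt0; case: #|G| => [|[]].
have [[F pF <-] minF] := mpP G_gt1.
apply/eqP; rewrite eqn_leq leq_card_precluding // andbT.
by rewrite -(card_star x) minF // (precluding_star x i).
Qed.

End OneFactorization.

(** A transposition determines its unordered pair of moved points; the inequalities fix the
    order. *)
Lemma tperm_ltn_inj (n : nat) (a b c d : 'I_n) :
  a < b -> c < d -> tperm a b = tperm c d -> (a, b) = (c, d).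
Proof.
move=> ab cd e; have := tpermL a b; rewrite e.
case: tpermP => [-> -> // | ad cb | _ _ eab].
  by move: ab; rewrite ad -cb ltnNge ltnW.
by rewrite eab ltnn in ab.
Qed.

(* Positions exchanged by the generators: [inl j] is the star pair (0, j + 1),
   [inr j] the bubble pair (j + 1, j + 2). *)
Definition gen_pair (m : nat) (k : 'I_m.+2 + 'I_m.+1) : 'I_m.+3 * 'I_m.+3 :=
  match k with
  | inl j => (ord0, lift ord0 j)
  | inr j => (lift ord0 (widen_ord (leqnSn _) j), lift ord0 (lift ord0 j))
  end.

Lemma gen_pair_ltn m (k : 'I_m.+2 + 'I_m.+1) : (gen_pair m k).1 < (gen_pair m k).2.
Proof. by case: k. Qed.

(** The first position is 0 for star pairs and positive for bubble pairs, so the families are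
    disjoint; within a family the second position determines the index. *)
Lemma gen_pair_inj m : injective (gen_pair m).
Proof.
by move=> [i|i] [j|j] // /(congr1 snd) /= /lift_inj // => [|/lift_inj] ->.
Qed.

Lemma gen_pairP m (i j : 'I_m.+3) :
  reflect (exists k, gen_pair m k = (i, j)) (star_pair i j || bubble_pair i j).
Proof.
apply: (iffP idP) => [/orP[] /andP[/eqP e j_gt] | [[k|k] [<- <-]]] //; last first.
- by rewrite /bubble_pair /= /bump /= !add1n eqxx.
(* The index is [j.-2] for a bubble pair and [j.-1] for a star pair below; the bounds on [j] keep
   these subtractions from truncating. *)
- have jlt : j.-2 < m.+1 by case: j j_gt {e} => [[|[]]].
  exists (inr (Ordinal jlt)); congr pair; apply: val_inj; rewrite /= /bump /= !add1n.
    by move: j_gt; rewrite e; case: (val i).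
  by move: j_gt; case: (val j) => [|[]].
have jlt : j.-1 < m.+2 by case: j j_gt => [[]].
exists (inl (Ordinal jlt)); congr pair; apply: val_inj => //=.
by rewrite /bump /= add1n prednK.
Qed.

Theorem theorem3p3 (n : nat) (hn : 3 <= n) : mp (BS n) = 2 * n - 3.
Proof.
case: n hn => [|[|[|m]]] // _.
pose s (k : 'I_m.+2 + 'I_m.+1) (v : BS m.+3) : BS m.+3 :=
  swap v (gen_pair m k).1 (gen_pair m k).2.
have sK k : involutive (s k) by move=> v; rewrite /s /swap mulgA tperm2 mul1g.
have s_inj v : injective (s^~ v).
  move=> k l /mulIg /tperm_ltn_inj e; apply: gen_pair_inj.
  by rewrite [LHS]surjective_pairing [RHS]surjective_pairing e ?gen_pair_ltn.
have adjE (u v : BS m.+3) : adj u v = [exists k, v == s k u].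
  (* [BS_adj] expresses its first vertex as a swap of the second, the opposite of [adjE]. *)
  rewrite adj_sym; apply/andP/existsP.
    case=> _ /existsP[i /existsP[j /andP[/gen_pairP[k ek] /eqP ->]]].
    by exists k; rewrite /s ek.
  case=> k /eqP ->; split.
    (* If the swap fixed [u], cancelling [u] would make the transposition trivial, yet it moves its
       first position. *)
    apply/eqP=> /(canRL (mulgK u)); rewrite mulgV => /permP /(_ (gen_pair m k).1).
    by rewrite tpermL perm1 => e; have := gen_pair_ltn _ k; rewrite e ltnn.
  apply/existsP; exists (gen_pair m k).1; apply/existsP; exists (gen_pair m k).2.
  by rewrite eqxx andbT; apply/gen_pairP; exists k; case: gen_pair.
(* With n = m + 3 there are (m + 2) + (m + 1) = 2n - 3 colours. *)
rewrite (mp_one_factorization _ _ s sK s_inj adjE 1%g (inl ord0)).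
by rewrite card_sum !card_ord mul2n -addnn !addSn !addnS !subSS subn0.
Qed.
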